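(* Let $L$ be a positive integer, let $r,\ell\ge 0$ and $\epsilon,\kappa,\lambda\in[-1,1]$, and let $J\in\mathbb{R}$ satisfy $e^{-J}=\frac{1-\epsilon}{1+\epsilon}$. Then for all $\varphi\in\mathbb{R}$ the periodic Ising measure $$\pi_L^\ast(\boldsymbol\eta)=\frac1{Z_L}\exp\Big(-J\sum_{k=1}^L\eta_k\eta_{k+1}+\varphi\sum_{k=1}^L\eta_k\Big),\qquad \boldsymbol\eta\in\{0,1\}^L,$$ is invariant for the generalized periodic Katz-Lebowitz-Spohn model, i.e. for the continuous-time Markov chain on $\{0,1\}^L$ with generator $$\mathcal L g(\boldsymbol\eta)=\sum_{k=1}^L w_k(\boldsymbol\eta)\,[g(\boldsymbol\eta^{k,k+1})-g(\boldsymbol\eta)]$$ and jump rates $w_k=r_k+\ell_{k+1}$ given by $$r_k(\boldsymbol\eta)=r\,\eta_k\bar\eta_{k+1}\big[(1+\kappa)(\bar\eta_{k-1}-\eta_{k+2})+(1+\epsilon)\eta_{k-1}+(1-\epsilon)\eta_{k+2}\big],$$ $$\ell_{k+1}(\boldsymbol\eta)=\ell\,\bar\eta_k\eta_{k+1}\big[(1+\lambda)(\bar\eta_{k-1}-\eta_{k+2})+(1-\epsilon)\eta_{k-1}+(1+\epsilon)\eta_{k+2}\big].$$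
   Context: Site indices are taken modulo $L$ (periodic boundary conditions). $\bar\eta_k:=1-\eta_k$. $\boldsymbol\eta^{k,k+1}$ is the configuration obtained from $\boldsymbol\eta$ by interchanging the values at sites $k$ and $k+1$. $Z_L$ is the normalization constant. The inverse temperature is set to $1$. A probability measure $\pi$ on $\{0,1\}^L$ is invariant if $\sum_{\boldsymbol\eta}\pi(\boldsymbol\eta)\mathcal L g(\boldsymbol\eta)=0$ for all functions $g:\{0,1\}^L\to\mathbb{R}$. *)

(* Defs.v *)
From mathcomp Require Import all_boot all_order all_fingroup all_algebra.
From mathcomp Require Import reals topology normedtype sequences exp.

Set Implicit Arguments.
Unset Strict Implicit.
Unset Printing Implicit Defensive.

Import Order.TTheory GRing.Theory Num.Theory.
Local Open Scope ring_scope.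

(* Sites are numbered 0, ..., L-1 and taken modulo L; k+1, k+2 and k-1 are
   [ordS k], [ordS (ordS k)] and [ord_pred k], which wrap around for every
   L > 0 (for L <= 3 some of the sites k-1, k, k+1, k+2 coincide). *)
Definition config (L : nat) := {ffun 'I_L -> bool}.

Definition occ (R : realType) (L : nat) (eta : config L) (k : 'I_L) : R :=
  (eta k)%:R.

Definition vac (R : realType) (L : nat) (eta : config L) (k : 'I_L) : R :=
  1 - occ R eta k.

Definition exchange (L : nat) (k : 'I_L) (eta : config L) : config L :=
  [ffun j => eta (tperm k (ordS k) j)].

Definition exchange_generator (R : realType) (L : nat)
    (w : 'I_L -> config L -> R) (g : config L -> R) (eta : config L) : R :=
  \sum_(k < L) w k eta * (g (exchange k eta) - g eta).

Definition probability_vector (R : realType) (L : nat) (p : config L -> R) :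
    Prop :=
  (forall eta, 0 <= p eta) /\ \sum_eta p eta = 1.

Definition invariant_measure (R : realType) (L : nat)
    (gen : (config L -> R) -> config L -> R) (p : config L -> R) : Prop :=
  probability_vector p /\
  forall g : config L -> R, \sum_eta p eta * gen g eta = 0.

Definition kls_right (R : realType) (L : nat) (r eps kappa : R)
    (k : 'I_L) (eta : config L) : R :=
  r * occ R eta k * vac R eta (ordS k) *
    ((1 + kappa) * (vac R eta (ord_pred k) - occ R eta (ordS (ordS k)))
     + (1 + eps) * occ R eta (ord_pred k)
     + (1 - eps) * occ R eta (ordS (ordS k))).

(* Indexed by the bond (k, k+1): this is the rate l_{k+1} at which a particle
   at k+1 jumps to k. *)
Definition kls_left (R : realType) (L : nat) (l eps lambda : R)
    (k : 'I_L) (eta : config L) : R :=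
  l * vac R eta k * occ R eta (ordS k) *
    ((1 + lambda) * (vac R eta (ord_pred k) - occ R eta (ordS (ordS k)))
     + (1 - eps) * occ R eta (ord_pred k)
     + (1 + eps) * occ R eta (ordS (ordS k))).

Definition kls_rate (R : realType) (L : nat) (r l eps kappa lambda : R)
    (k : 'I_L) (eta : config L) : R :=
  kls_right r eps kappa k eta + kls_left l eps lambda k eta.

Definition kls_generator (R : realType) (L : nat) (r l eps kappa lambda : R) :
    (config L -> R) -> config L -> R :=
  exchange_generator (kls_rate r l eps kappa lambda).

Definition ising_weight (R : realType) (L : nat) (J phi : R)
    (eta : config L) : R :=
  expR (- J * (\sum_(k < L) occ R eta k * occ R eta (ordS k))
        + phi * \sum_(k < L) occ R eta k).

Definition ising_Z (R : realType) (L : nat) (J phi : R) : R :=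
  \sum_(eta : config L) ising_weight J phi eta.

Definition ising_measure (R : realType) (L : nat) (J phi : R)
    (eta : config L) : R :=
  (ising_Z L J phi)^-1 * ising_weight J phi eta.

(* Main.v *)
Require Import Defs.
From mathcomp Require Import all_boot all_order all_fingroup all_algebra.
From mathcomp Require Import reals topology normedtype sequences exp.
From mathcomp Require Import ring zify.

Set Implicit Arguments.
Unset Strict Implicit.
Unset Printing Implicit Defensive.

Import Order.TTheory GRing.Theory Num.Theory.
Local Open Scope ring_scope.

(** Each exchange [eta |-> exchange k eta] is an involution, so invariance of a
    measure p amounts to the master equation
      sum_k w_k(eta^{k,k+1}) p(eta^{k,k+1}) = sum_k w_k(eta) p(eta)
    for every eta ([balance_stationary]).  The dynamics is driven, hence in
    general not reversible, and the two sides do not agree bond by bond.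

    What saves the Ising measure is that the mismatch is a discrete gradient.
    Exchanging the sites k and k+1 keeps the number of particles and changes
    the number of occupied neighbouring pairs only through the four sites
    k-1, ..., k+2 ([pairs_exchange]), so that the ratio of the two weights is a
    power of exp(-J) = (1 - eps) / (1 + eps) with exponent -1, 0 or 1.  This is
    just the ratio of the rates 1 - eps and 1 + eps of the hops that make or
    break a pair.  As a result the gain minus loss term of the bond (k, k+1),
    divided by p(eta), equals h_{k+1} - h_k, where h_k is a polynomial in the
    occupation numbers of k-1, k, k+1 ([local_balance]), and the sum over the
    ring telescopes ([kls_balance_large]).

    The four sites k-1, ..., k+2 carry three different bonds only if L >= 3
    (for L = 3 the outer two sites coincide, which does no harm).  On a ring of
    one or two sites every exchange is the rotation by one site, which
    preserves the Ising weight and permutes the rates cyclically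
    ([kls_balance_small]). *)

(** * Stationarity of an exchange dynamics *)

Lemma exchangeK (L : nat) (k : 'I_L) : involutive (exchange k).
Proof. by move=> eta; apply/ffunP => j; rewrite !ffunE tpermK. Qed.

(** Substituting [exchange k eta] for [eta] in the gain term moves the exchange
    from the test function g onto the rate and the measure, leaving g eta as a
    common factor. *)
Lemma balance_stationary (R : realType) (L : nat)
    (w : 'I_L -> config L -> R) (p : config L -> R) :
  (forall eta, \sum_(k < L) w k (exchange k eta) * p (exchange k eta)
               = \sum_(k < L) w k eta * p eta) ->
  forall g, \sum_eta p eta * exchange_generator w g eta = 0.
Proof.
move=> balance g.
transitivity (\sum_eta \sum_(k < L) (g (exchange k eta) * (w k eta * p eta))
              - \sum_eta \sum_(k < L) g eta * (w k eta * p eta)).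
  rewrite -sumrB; apply: eq_bigr => eta _.
  rewrite -sumrB mulr_sumr; apply: eq_bigr => k _; ring.
apply/eqP; rewrite subr_eq0; apply/eqP.
transitivity (\sum_(k < L) \sum_eta
    g eta * (w k (exchange k eta) * p (exchange k eta))).
  rewrite exchange_big; apply: eq_bigr => k _ /=.
  rewrite (reindex_inj (inv_inj (exchangeK k))) /=.
  by apply: eq_bigr => eta _; rewrite exchangeK.
rewrite exchange_big; apply: eq_bigr => eta _ /=.
by rewrite -!mulr_sumr balance.
Qed.

(** * The ring of sites *)

Lemma sum_ordS (V : nmodType) (L : nat) (f : 'I_L -> V) :
  \sum_(k < L) f (ordS k) = \sum_(k < L) f k.
Proof. by rewrite [RHS](reindex_inj (can_inj (@ordSK L))). Qed.

Lemma ordS_neq (L : nat) (k : 'I_L) : (1 < L)%N -> ordS k != k.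
Proof.
case: k => k ltkL L_gt1; rewrite -val_eqE /=.
have [eqL|ltL] : k.+1 = L \/ (k.+1 < L)%N by lia.
  by rewrite eqL modnn; lia.
by rewrite modn_small //; lia.
Qed.

Lemma ordS2_neq (L : nat) (k : 'I_L) : (2 < L)%N -> ordS (ordS k) != k.
Proof.
case: k => k ltkL L_gt2; rewrite -val_eqE /=.
have [eqL|ltL] : k.+1 = L \/ (k.+1 < L)%N by lia.
  by rewrite eqL modnn modn_small; lia.
rewrite (modn_small ltL).
have [eqL|ltL2] : k.+2 = L \/ (k.+2 < L)%N by lia.
  by rewrite eqL modnn; lia.
by rewrite modn_small //; lia.
Qed.

Lemma tperm_ordS_small (L : nat) (k j : 'I_L) :
  (L <= 2)%N -> tperm k (ordS k) j = ordS j.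
Proof.
case: L k j => [|[|[|L]]] k j //= _; first by case: k.
  by apply/val_inj; rewrite !ord1.
have ordSS (i : 'I_2) : ordS (ordS i) = i.
  by apply/val_inj; case: i => [[|[|]]].
case: tpermP => [-> //|-> //|/eqP jk /eqP jSk].
case/negP: jSk; move: jk; rewrite -!val_eqE /=.
by case: j k => [[|[|]] ?] // [[|[|]] ?].
Qed.

(** * The local gradient identity *)

(** The rate of the bond (k, k+1) as a function of the occupation numbers
    a, b, c, d of the sites k-1, k, k+1, k+2. *)
Definition local_rate (R : realType) (r l eps kappa lambda : R)
    (a b c d : R) : R :=
  r * b * (1 - c) *
    ((1 + kappa) * ((1 - a) - d) + (1 + eps) * a + (1 - eps) * d)
  + l * (1 - b) * c *
    ((1 + lambda) * ((1 - a) - d) + (1 - eps) * a + (1 + eps) * d).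

(** Divided by the Ising weight, the gain minus loss term of hops to the right
    at unit attempt rate is
      (c - b) (1 + mu (1 - a - d)) + eps (d - a) (b + c - 2 b c),
    with mu = kappa.  Expanding, each product pairs with its translate by one
    site, as in d c - a b = (d c + c b) - (c b + b a); collecting the
    untranslated halves gives this polynomial. *)
Definition one_way_potential (R : realType) (eps mu a b c : R) : R :=
  (1 + mu) * b + mu * (a * c - a * b - b * c)
  + eps * (a * c + a * b + b * c - 2 * a * b * c).

(** Hops to the left give the gain minus loss terms of hops to the right with
    the opposite sign, and lambda in the place of kappa. *)
Definition potential (R : realType) (r l eps kappa lambda a b c : R) : R :=
  r * one_way_potential eps kappa a b c
  - l * one_way_potential eps lambda a b c.

(** The exponents count the occupied pairs among the three bonds after and
    before the exchange, less the bond (k, k+1) itself, which contributes b * c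
    both times.  Written with powers on both sides, the identity avoids the
    negative exponent of the weight ratio. *)
Lemma local_balance (R : realType) (r l eps kappa lambda x : R)
    (a b c d : bool) :
  1 + eps != 0 -> 1 - eps != 0 -> x = (1 - eps) / (1 + eps) ->
  local_rate r l eps kappa lambda a%:R c%:R b%:R d%:R * x ^+ (a * c + b * d)%N
  = (local_rate r l eps kappa lambda a%:R b%:R c%:R d%:R
     + (potential r l eps kappa lambda b%:R c%:R d%:R
        - potential r l eps kappa lambda a%:R b%:R c%:R))
    * x ^+ (a * b + c * d)%N.
Proof.
move=> e1 e2 ->; rewrite /local_rate /potential /one_way_potential.
by case: a; case: b; case: c; case: d => /=; rewrite ?expr0 ?expr1; field.
Qed.

Lemma kls_rateE (R : realType) (L : nat) (r l eps kappa lambda : R)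
    (k : 'I_L) (eta : config L) :
  kls_rate r l eps kappa lambda k eta =
  local_rate r l eps kappa lambda (eta (ord_pred k))%:R (eta k)%:R
    (eta (ordS k))%:R (eta (ordS (ordS k)))%:R.
Proof. by []. Qed.

(** * Particles and pairs under an exchange *)

Definition particles (L : nat) (eta : config L) : nat := (\sum_(k < L) eta k)%N.

Definition pairs (L : nat) (eta : config L) : nat :=
  (\sum_(k < L) eta k * eta (ordS k))%N.

Lemma ising_weightE (R : realType) (L : nat) (J phi : R) (eta : config L) :
  ising_weight J phi eta =
  expR (- J) ^+ pairs eta * expR phi ^+ particles eta.
Proof.
rewrite /ising_weight expRD /pairs /particles -!expRM_natr !natr_sum.
by congr (expR (_ * _) * _); apply: eq_bigr => k _; rewrite natrM.
Qed.

Lemma particles_exchange (L : nat) (k : 'I_L) (eta : config L) :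
  particles (exchange k eta) = particles eta.
Proof.
rewrite /particles [RHS](reindex_inj (@perm_inj _ (tperm k (ordS k)))).
by apply: eq_bigr => j _; rewrite ffunE.
Qed.

(** Only the bonds (k-1, k), (k, k+1) and (k+1, k+2) see the exchange; they are
    three different bonds because L > 2. *)
Lemma pairs_exchange (L : nat) (k : 'I_L) (eta : config L) : (2 < L)%N ->
  let a := eta (ord_pred k) in let b := eta k in
  let c := eta (ordS k) in let d := eta (ordS (ordS k)) in
  (pairs (exchange k eta) + (a * b + c * d) = pairs eta + (a * c + b * d))%N.
Proof.
move=> L_gt2 /=; have L_gt1 := ltnW L_gt2.
have ordS_inj := can_inj (@ordSK L).
(* The leftmost site m serves as the origin, so that all sites are successors
   of m and no predecessor is left. *)
rewrite -(ord_predK k); move: (ord_pred k) => m; rewrite ordSK.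
have n1 j := negPf (ordS_neq j L_gt1).
have n2 j := negPf (ordS2_neq j L_gt2).
have split3 (f : 'I_L -> nat) : (\sum_j f j = f m + (f (ordS m) +
    (f (ordS (ordS m)) + \sum_(j | [&& j != m, j != ordS m &
       j != ordS (ordS m)]) f j)))%N.
  rewrite (bigD1 m) //= (bigD1 (ordS m)) ?n1 //=.
  rewrite (bigD1 (ordS (ordS m))) ?n1 ?n2 //=.
  by do 3 congr addn; apply: eq_bigl => j; rewrite -!andbA.
have exchE j : exchange (ordS m) eta j =
    eta (if j == ordS m then ordS (ordS m)
         else if j == ordS (ordS m) then ordS m else j).
  by rewrite ffunE permE.
rewrite /pairs !split3 !exchE.
rewrite (eq_bigr (fun j => (eta j * eta (ordS j))%N)); last first.
  move=> j /and3P[jm jm1 jm2]; rewrite !exchE.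
  by rewrite !(inj_eq ordS_inj) (negPf jm) (negPf jm1) (negPf jm2).
rewrite !eqxx !(inj_eq ordS_inj) ![m == _]eq_sym !n1 !n2 /=.
by ring.
Qed.

(** * The master equation for the Ising weight *)

Lemma exchange_small (L : nat) (k : 'I_L) (eta : config L) : (L <= 2)%N ->
  exchange k eta = [ffun j => eta (ordS j)].
Proof. by move=> L_le2; apply/ffunP => j; rewrite !ffunE tperm_ordS_small. Qed.

(** After the rotation the bond k sees what the bond k+1 saw before, so the two
    sums differ by a cyclic shift of the summation index. *)
Lemma kls_balance_small (R : realType) (L : nat)
    (r l eps kappa lambda J phi : R) (eta : config L) : (L <= 2)%N ->
  \sum_(k < L) kls_rate r l eps kappa lambda k (exchange k eta)
    * ising_weight J phi (exchange k eta)
  = \sum_(k < L) kls_rate r l eps kappa lambda k eta * ising_weight J phi eta.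
Proof.
move=> L_le2; rewrite -[RHS]sum_ordS; apply: eq_bigr => k _; congr (_ * _).
  by rewrite exchange_small // !kls_rateE !ffunE ordSK ord_predK.
rewrite !ising_weightE particles_exchange exchange_small //.
congr (_ ^+ _ * _); rewrite /pairs -[RHS]sum_ordS.
by apply: eq_bigr => j _; rewrite !ffunE.
Qed.

Lemma kls_balance_large (R : realType) (L : nat)
    (r l eps kappa lambda J phi : R) (eta : config L) : (2 < L)%N ->
  expR (- J) = (1 - eps) / (1 + eps) ->
  \sum_(k < L) kls_rate r l eps kappa lambda k (exchange k eta)
    * ising_weight J phi (exchange k eta)
  = \sum_(k < L) kls_rate r l eps kappa lambda k eta * ising_weight J phi eta.
Proof.
move=> L_gt2 hJ.
(* expR never vanishes and division by 0 gives 0, so eps is neither 1 nor -1. *)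
have /andP[e2 e1] : (1 - eps != 0) && (1 + eps != 0).
  by have := lt0r_neq0 (expR_gt0 (- J)); rewrite hJ mulf_eq0 invr_eq0 negb_or.
pose h k := potential r l eps kappa lambda
  (eta (ord_pred k))%:R (eta k)%:R (eta (ordS k))%:R.
transitivity (\sum_(k < L)
    (kls_rate r l eps kappa lambda k eta * ising_weight J phi eta
     + (h (ordS k) - h k) * ising_weight J phi eta)); last first.
  rewrite big_split /= -[X in _ + X]mulr_suml sumrB.
  by rewrite sum_ordS subrr mul0r addr0.
apply: eq_bigr => k _.
have L_gt1 := ltnW L_gt2.
have := pairs_exchange k eta L_gt2.
have := local_balance r l kappa lambda (eta (ord_pred k)) (eta k)
  (eta (ordS k)) (eta (ordS (ordS k))) e1 e2 hJ.
rewrite /= /h ordSK => bal pairsE.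
have -> : kls_rate r l eps kappa lambda k (exchange k eta) =
  local_rate r l eps kappa lambda
  (eta (ord_pred k))%:R (eta (ordS k))%:R (eta k)%:R (eta (ordS (ordS k)))%:R.
  rewrite kls_rateE !ffunE tpermL tpermR !tpermD //.
  - by rewrite eq_sym ordS2_neq.
  - by rewrite eq_sym ordS_neq.
  - by rewrite -{1}(ord_predK k) ordS_neq.
  - by rewrite -{1}(ord_predK k) ordS2_neq.
rewrite -mulrDl kls_rateE !ising_weightE particles_exchange !mulrA.
congr (_ * _).
set x := expR (- J) in bal *; set n := (_ + _)%N in bal pairsE.
set m := (_ + _)%N in bal; rewrite -/m in pairsE.
have xm0 : x ^+ m != 0 by rewrite expf_neq0 // lt0r_neq0 ?expR_gt0.
apply: (mulIf xm0).
by rewrite -mulrA -exprD pairsE exprD mulrCA bal mulrCA mulrA.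
Qed.

Theorem theorem4p1 (R : realType) (L : nat) (hL : (0 < L)%N)
    (r l eps kappa lambda J : R)
    (hr : 0 <= r) (hl : 0 <= l)
    (heps : -1 <= eps <= 1) (hkappa : -1 <= kappa <= 1)
    (hlambda : -1 <= lambda <= 1)
    (hJ : expR (- J) = (1 - eps) / (1 + eps)) :
  forall phi : R,
    invariant_measure (kls_generator (L := L) r l eps kappa lambda)
      (ising_measure (L := L) J phi).
Proof.
move=> phi.
have Z_gt0 : 0 < ising_Z L J phi.
  (* the empty configuration witnesses that the sum is not empty *)
  rewrite /ising_Z (bigD1 [ffun=> false]) //= ltr_wpDr ?expR_gt0 //.
  by apply: sumr_ge0 => eta _; exact: expR_ge0.
split; first split.
- by move=> eta; rewrite mulr_ge0 ?invr_ge0 ?expR_ge0 // ltW.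
- by rewrite -mulr_sumr mulVf // lt0r_neq0.
apply: balance_stationary => eta.
under eq_bigr do rewrite mulrCA; under [RHS]eq_bigr do rewrite mulrCA.
rewrite -!mulr_sumr; congr (_ * _).
by case: (leqP L 2) => [/kls_balance_small|/kls_balance_large]; exact.
Qed.
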